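(* Let $n\ge 1$, $\lambda>0$ and $\sigma_1\ge\dots\ge\sigma_{n-1}\ge 1$, let $\mu$ be the Lorentzian inner product $\operatorname{diag}\{\sigma_1,\sigma_1,\dots,\sigma_{n-1},\sigma_{n-1},1,1,-\lambda\}$ on the Heisenberg Lie algebra $\mathfrak{h}_{2n+1}$ in the basis $\{f_1,g_1,\dots,f_n,g_n,z\}$, and let $\mathscr{B}=\{v_1,\dots,v_{2n+1}\}$ be the orthonormal basis given by $v_{2k-1}=\frac{1}{\sqrt{\sigma_k}}f_k$, $v_{2k}=\frac{1}{\sqrt{\sigma_k}}g_k$ for $1\le k\le n-1$, $v_{2n-1}=f_n$, $v_{2n}=g_n$, $v_{2n+1}=\frac{1}{\sqrt{\lambda}}z$. Then the Levi-Civita connection $\nabla$ of $(\mathfrak{h}_{2n+1},\mu)$ satisfies $\nabla_{v_i}v_i=0$ for all $i=1,\dots,2n+1$; for every $k=1,\dots,n-1$, $$\nabla_{v_{2k-1}}v_{2k}=-\nabla_{v_{2k}}v_{2k-1}=\frac{\sqrt{\lambda}}{2\sigma_k}v_{2n+1},$$ $$\nabla_{v_{2k-1}}v_{2n+1}=\nabla_{v_{2n+1}}v_{2k-1}=\frac{\sqrt{\lambda}}{2\sigma_k}v_{2k},\qquad \nabla_{v_{2k}}v_{2n+1}=\nabla_{v_{2n+1}}v_{2k}=-\frac{\sqrt{\lambda}}{2\sigma_k}v_{2k-1};$$ $$\nabla_{v_{2n-1}}v_{2n}=-\nabla_{v_{2n}}v_{2n-1}=\frac{\sqrt{\lambda}}{2}v_{2n+1},$$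 $$\nabla_{v_{2n-1}}v_{2n+1}=\nabla_{v_{2n+1}}v_{2n-1}=\frac{\sqrt{\lambda}}{2}v_{2n},\qquad \nabla_{v_{2n}}v_{2n+1}=\nabla_{v_{2n+1}}v_{2n}=-\frac{\sqrt{\lambda}}{2}v_{2n-1};$$ and all the other terms $\nabla_{v_a}v_b$ are zero.
   Context: The Heisenberg Lie algebra $\mathfrak{h}_{2n+1}$ is the real Lie algebra with basis $\{f_1,g_1,\dots,f_n,g_n,z\}$ whose only nonzero brackets of basis elements (up to antisymmetry) are $[f_i,g_i]=z$, $i=1,\dots,n$. For $n=1$ there are no $\sigma_k$. A Lorentzian inner product is a nondegenerate symmetric bilinear form of signature $(2n,1)$; an orthonormal basis $\{v_1,\dots,v_m\}$ satisfies $\langle v_i,v_j\rangle=0$ for $i\ne j$, $\langle v_i,v_i\rangle=1$ for $i<m$, and $\langle v_m,v_m\rangle=-1$. The Levi-Civita connection of $(\mathfrak{g},\langle\cdot,\cdot\rangle)$ is the bilinear map $(u,v)\mapsto\nabla_uv$ on $\mathfrak{g}$ determined by the Koszul formula $2\langle\nabla_uv,w\rangle=\langle[u,v],w\rangle+\langle[w,u],v\rangle+\langle[w,v],u\rangle$ for all $u,v,w\in\mathfrak{g}$. *)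

(* Defs.v *)
From HB Require Import structures.
From mathcomp Require Import all_boot all_order all_algebra.
From mathcomp Require Import sesquilinear reals.
From mathcomp Require Import ring lra zify.

Set Implicit Arguments.
Unset Strict Implicit.
Unset Printing Implicit Defensive.

Import Order.TTheory GRing.Theory Num.Theory.
Local Open Scope ring_scope.

(* Basis vectors are numbered from 1, in the order f_1, g_1, ..., f_n, g_n, z.
   [ix n j] is the coordinate of number [j]; it is meaningful for
   1 <= j <= 2n + 1 only. *)
Definition ix (n j : nat) : 'I_(2 * n).+1 := inord j.-1.

Section Heisenberg.
Variables (R : realType) (n : nat).
Local Notation V := 'rV[R]_(2 * n).+1.

Definition heis_f (k : nat) : V := delta_mx 0 (ix n (2 * k - 1)).
Definition heis_g (k : nat) : V := delta_mx 0 (ix n (2 * k)).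
Definition heis_z : V := delta_mx 0 (ix n (2 * n + 1)).

(* Bilinear extension of [f_k, g_k] = - [g_k, f_k] = z;
   see [heis_br_table] and [heis_br_jacobi]. *)
Definition heis_br (u v : V) : V :=
  (\sum_(1 <= k < n.+1)
     (u 0 (ix n (2 * k - 1)) * v 0 (ix n (2 * k))
      - u 0 (ix n (2 * k)) * v 0 (ix n (2 * k - 1)))) *: heis_z.

Variables (sigma : nat -> R) (lambda : R).

(* Only sigma_1, ..., sigma_(n-1) are used.  The row index [i] is an ordinal,
   hence starts from 0: coordinates 2(k-1) and 2(k-1)+1 are f_k and g_k. *)
Definition lorentz_diag : V :=
  \row_(i < (2 * n).+1)
    if (i < 2 * (n - 1))%N then sigma i./2.+1
    else if (i < 2 * n)%N then 1 else - lambda.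

Definition lorentz (u v : V) : R :=
  (u *m diag_mx lorentz_diag *m v^T) 0 0.

(* v_1, ..., v_(2n+1); [uphalf j] is k both for j = 2k - 1 and for j = 2k. *)
Definition onb (j : nat) : V :=
  if (j <= 2 * (n - 1))%N then
    (Num.sqrt (sigma (uphalf j)))^-1
      *: (if odd j then heis_f (uphalf j) else heis_g (uphalf j))
  else if j == (2 * n - 1)%N then heis_f n
  else if j == (2 * n)%N then heis_g n
  else (Num.sqrt lambda)^-1 *: heis_z.

End Heisenberg.

(* The Koszul formula; for [heis_br] and [lorentz] it has exactly one solution,
   see [levi_civita_exists_unique]. *)
Definition levi_civita (R : realType) (V : lmodType R) (br : V -> V -> V)
    (mu : V -> V -> R) (nabla : {bilinear V -> V -> V}) : Prop :=
  forall u v w : V,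
    2 * mu (nabla u v) w = mu (br u v) w + mu (br w u) v + mu (br w v) u.

(* The pairs of indices occurring in the displayed formulas for [nabla],
   with k = n included. *)
Definition listed_pair (n a b : nat) : Prop :=
  exists2 k : nat, (1 <= k <= n)%N &
    (a, b) \in [:: (2 * k - 1, 2 * k); (2 * k, 2 * k - 1);
                   (2 * k - 1, 2 * n + 1); (2 * n + 1, 2 * k - 1);
                   (2 * k, 2 * n + 1); (2 * n + 1, 2 * k)]%N.

Section Facts.
Variables (R : realType) (n : nat).
Local Notation V := 'rV[R]_(2 * n).+1.

Lemma val_ix j : (1 <= j <= 2 * n + 1)%N -> ix n j = j.-1 :> nat.
Proof. by move=> jn; rewrite /ix inordK //; lia. Qed.

Lemma delta_ix i j : (1 <= i <= 2 * n + 1)%N -> (1 <= j <= 2 * n + 1)%N ->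
  (delta_mx 0 (ix n i) : V) 0 (ix n j) = (i == j)%:R.
Proof.
move=> hi hj; rewrite mxE eqxx /= -val_eqE /= !val_ix //.
by congr ((nat_of_bool _)%:R); lia.
Qed.

Lemma heis_br_is_bilinear : bilinear_for
  (GRing.Scale.Law.clone _ _ *:%R _) (GRing.Scale.Law.clone _ _ *:%R _)
  (@heis_br R n).
Proof.
split=> [v a u u'|u a v v']; rewrite /heis_br /= scalerA -scalerDl;
  congr (_ *: _); rewrite big_distrr -big_split /=; apply: eq_bigr => k _;
  rewrite !mxE; ring.
Qed.

HB.instance Definition _ := bilinear_isBilinear.Build R V V V _ _
  (@heis_br R n) heis_br_is_bilinear.

Lemma heis_br_alt (u : V) : heis_br u u = 0.
Proof.
by rewrite /heis_br big1 ?scale0r // => k _; rewrite mulrC subrr.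
Qed.

Lemma heis_br_z (u : V) : heis_br u (heis_z R n) = 0.
Proof.
rewrite /heis_br /heis_z big_nat big1 ?scale0r // => k hk.
rewrite !delta_ix; try lia.
have /negbTE-> : (2 * n + 1 != 2 * k)%N by lia.
have /negbTE-> : (2 * n + 1 != 2 * k - 1)%N by lia.
by rewrite !mulr0 subrr.
Qed.

Lemma heis_br_jacobi (u v w : V) :
  heis_br u (heis_br v w) + heis_br v (heis_br w u)
  + heis_br w (heis_br u v) = 0.
Proof.
rewrite /(heis_br v w) /(heis_br w u) /(heis_br u v).
by rewrite !linearZr_LR /= !heis_br_z !scaler0 !addr0.
Qed.

Lemma heis_br_table i j : (1 <= i <= n)%N -> (1 <= j <= n)%N ->
  [/\ heis_br (heis_f R n i) (heis_g R n j) = (i == j)%:R *: heis_z R n,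
      heis_br (heis_f R n i) (heis_f R n j) = 0,
      heis_br (heis_g R n i) (heis_g R n j) = 0,
      heis_br (heis_f R n i) (heis_z R n) = 0
    & heis_br (heis_g R n i) (heis_z R n) = 0].
Proof.
move=> hi hj; split; rewrite ?heis_br_z //.
- rewrite /heis_br; congr (_ *: _).
  rewrite (bigD1_seq i) ?iota_uniq ?mem_index_iota //= /heis_f /heis_g.
  rewrite big1_seq ?addr0 => [|k]; last first.
    rewrite mem_index_iota => /andP[ki hk]; rewrite !delta_ix; try lia.
    have /negbTE-> : (2 * i - 1 != 2 * k - 1)%N by lia.
    have /negbTE-> : (2 * i - 1 != 2 * k)%N by lia.
    by rewrite !mul0r subrr.
  rewrite !delta_ix; try lia.
  have /negbTE-> : (2 * i - 1 != 2 * i)%N by lia.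
  rewrite eqxx mul1r mul0r subr0; congr ((nat_of_bool _)%:R); lia.
- rewrite /heis_br big_nat big1 ?scale0r // => k hk.
  rewrite /heis_f !delta_ix; try lia.
  have /negbTE-> : (2 * j - 1 != 2 * k)%N by lia.
  have /negbTE-> : (2 * i - 1 != 2 * k)%N by lia.
  by rewrite mulr0 mul0r subrr.
- rewrite /heis_br big_nat big1 ?scale0r // => k hk.
  rewrite /heis_g !delta_ix; try lia.
  have /negbTE-> : (2 * j != 2 * k - 1)%N by lia.
  have /negbTE-> : (2 * i != 2 * k - 1)%N by lia.
  by rewrite mulr0 mul0r subrr.
Qed.

Variables (sigma : nat -> R) (lambda : R).
Local Notation mu := (lorentz sigma lambda).
Local Notation d := (lorentz_diag n sigma lambda).
Local Notation v := (onb n sigma lambda).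

Lemma lorentzE (x y : V) : mu x y = \sum_i d 0 i * x 0 i * y 0 i.
Proof.
rewrite /lorentz mxE; apply: eq_bigr => i _.
by rewrite mul_mx_diag !mxE; ring.
Qed.

Lemma lorentz_is_bilinear : bilinear_for
  (GRing.Scale.Law.clone _ _ *%R _) (GRing.Scale.Law.clone _ _ *%R _)
  (mu : V -> V -> R).
Proof.
split=> [y a x x'|x a y y']; rewrite !lorentzE /= big_distrr -big_split /=;
  apply: eq_bigr => i _; rewrite !mxE; ring.
Qed.

HB.instance Definition _ := bilinear_isBilinear.Build R V V R _ _
  (@lorentz R n sigma lambda) lorentz_is_bilinear.

Lemma lorentzC (x y : V) : mu x y = mu y x.
Proof. by rewrite !lorentzE; apply: eq_bigr => i _; ring. Qed.

Lemma lorentz_delta (x : V) i : mu x (delta_mx 0 i) = d 0 i * x 0 i.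
Proof.
rewrite lorentzE (bigD1 i) //= big1 ?addr0 => [|j ji].
  by rewrite !mxE !eqxx mulr1.
by rewrite [delta_mx _ _ _ _]mxE (negbTE ji) andbF mulr0.
Qed.

Hypothesis n_gt0 : (1 <= n)%N.

Lemma onb_odd k : (1 <= k <= n - 1)%N ->
  v (2 * k - 1) = (Num.sqrt (sigma k))^-1 *: heis_f R n k.
Proof.
move=> hk; rewrite /onb ifT; last lia.
have -> : uphalf (2 * k - 1) = k by lia.
by have -> : odd (2 * k - 1) by lia.
Qed.

Lemma onb_even k : (1 <= k <= n - 1)%N ->
  v (2 * k) = (Num.sqrt (sigma k))^-1 *: heis_g R n k.
Proof.
move=> hk; rewrite /onb ifT; last lia.
have -> : uphalf (2 * k) = k by lia.
by have -> : odd (2 * k) = false by lia.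
Qed.

Lemma onb_last :
  [/\ v (2 * n - 1) = heis_f R n n, v (2 * n) = heis_g R n n
    & v (2 * n + 1) = (Num.sqrt lambda)^-1 *: heis_z R n].
Proof.
by split; rewrite /onb ifF ?eqxx //; try lia;
  do ?[rewrite ifF; last lia].
Qed.

Hypothesis lambda_gt0 : 0 < lambda.
Hypothesis sigma_ge1 : forall k : nat, (1 <= k <= n - 1)%N -> 1 <= sigma k.

Lemma lorentz_diag_neq0 i : d 0 i != 0.
Proof.
rewrite mxE; case: ifP => h1; last first.
  by case: ifP => _; rewrite ?oppr_eq0 ?oner_eq0 ?gt_eqF.
have := @sigma_ge1 i./2.+1; have -> : (1 <= i./2.+1 <= n - 1)%N by lia.
by move=> /(_ isT) s1; rewrite gt_eqF // (lt_le_trans _ s1).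
Qed.

Lemma lorentz_nondeg (x : V) : (forall y, mu x y = 0) -> x = 0.
Proof.
move=> h; apply/rowP => i; rewrite [RHS]mxE; apply/eqP.
have /eqP := h (delta_mx 0 i).
by rewrite lorentz_delta mulf_eq0 (negbTE (lorentz_diag_neq0 i)).
Qed.

Definition onb_coef (j : nat) : R :=
  if (j <= 2 * (n - 1))%N then (Num.sqrt (sigma (uphalf j)))^-1
  else if (j <= 2 * n)%N then 1 else (Num.sqrt lambda)^-1.

Lemma onbE j : (1 <= j <= 2 * n + 1)%N ->
  v j = onb_coef j *: delta_mx 0 (ix n j).
Proof.
move=> hj; rewrite /onb /onb_coef /heis_f /heis_g /heis_z.
case: ifP => h1.
  by congr (_ *: _); case: ifP => h; congr (delta_mx _ (ix n _)); lia.
case: eqP => [->|h2]; first by rewrite ifT ?scale1r //; lia.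
case: eqP => [->|h3]; first by rewrite ifT ?scale1r //; lia.
rewrite ifF; last lia.
by congr (_ *: delta_mx _ (ix n _)); lia.
Qed.

Lemma onb_orthonormal a b :
  (1 <= a <= 2 * n + 1)%N -> (1 <= b <= 2 * n + 1)%N ->
  mu (v a) (v b) =
    if a == b then (if (a <= 2 * n)%N then 1 else -1) else 0.
Proof.
move=> ha hb; rewrite !onbE // linearZr_LR /= lorentz_delta.
have -> : (onb_coef a *: delta_mx 0 (ix n a) : V) 0 (ix n b)
    = onb_coef a * (a == b)%:R by rewrite mxE delta_ix.
case: eqP => [<-|_]; last by rewrite !mulr0.
rewrite mulr1 mulrCA -expr2 mxE val_ix // /onb_coef.
have sq (x : R) : 0 < x -> (Num.sqrt x)^-1 ^+ 2 = x^-1.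
  by move=> x0; rewrite exprVn sqr_sqrtr // ltW.
case: (leqP a (2 * (n - 1))) => h1.
  rewrite ifT; last lia.
  rewrite (_ : (a <= 2 * n)%N); last lia.
  have -> : a.-1./2.+1 = uphalf a by lia.
  have s1 : 0 < sigma (uphalf a).
    by apply: (lt_le_trans ltr01); apply: sigma_ge1; lia.
  by rewrite sq ?divff // ?gt_eqF //; case: leqP; lia.
rewrite ifF; last lia.
case: (leqP a (2 * n)) => h2; first by rewrite ifT ?expr1n ?mulr1 //; lia.
by rewrite ifF ?sq ?mulNr ?divff // ?gt_eqF //; lia.
Qed.

Definition koszul_sol (x y : V) : V :=
  \row_i ((2 * d 0 i)^-1 *
    (mu (heis_br x y) (delta_mx 0 i) + mu (heis_br (delta_mx 0 i) x) y
     + mu (heis_br (delta_mx 0 i) y) x)).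

Lemma koszul_sol_is_bilinear : bilinear_for
  (GRing.Scale.Law.clone _ _ *:%R _) (GRing.Scale.Law.clone _ _ *:%R _)
  koszul_sol.
Proof.
split=> [y a x x'|x a y y']; apply/rowP => i; rewrite !mxE.
  by rewrite !(linearPr, linearPl) /=; ring.
by rewrite !(linearPr, linearPl) /=; ring.
Qed.

HB.instance Definition _ := bilinear_isBilinear.Build R V V V _ _
  koszul_sol koszul_sol_is_bilinear.

Lemma levi_civita_exists_unique :
  (exists nabla : {bilinear V -> V -> V}, levi_civita (@heis_br R n) mu nabla)
  /\ (forall nabla nabla' : {bilinear V -> V -> V},
        levi_civita (@heis_br R n) mu nabla ->
        levi_civita (@heis_br R n) mu nabla' -> nabla =2 nabla').
Proof.
split; last first.
  move=> p q hp hq x y; apply/eqP; rewrite -subr_eq0; apply/eqP.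
  apply: lorentz_nondeg => w; rewrite linearBl /=.
  by have := hp x y w; rewrite -hq => /(mulfI _) ->; rewrite ?subrr ?pnatr_eq0.
exists koszul_sol => x y w.
rewrite [w in RHS]row_sum_delta [w in LHS]row_sum_delta.
rewrite !(linear_sumr, linear_sumlz) /= big_distrr -!big_split /=.
apply: eq_bigr => i _.
have brZ (c : R) (p q : V) : heis_br (c *: p) q = c *: heis_br p q.
  by rewrite linearZl_LR.
have muZl (c : R) (p q : V) : mu (c *: p) q = c * mu p q.
  by rewrite linearZl_LR.
have muZr (c : R) (p q : V) : mu p (c *: q) = c * mu p q.
  by rewrite linearZr_LR.
rewrite !muZr !brZ !(muZl (w 0 i)) lorentz_delta [koszul_sol x y 0 i]mxE.
rewrite -!mulrDr mulrCA; congr (_ * _).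
rewrite mulrA mulVKf //.
by rewrite mulf_neq0 ?pnatr_eq0 ?lorentz_diag_neq0.
Qed.

End Facts.

(* Main.v *)
Require Import Defs.
From mathcomp Require Import all_boot all_order all_algebra.
From mathcomp Require Import sesquilinear reals.
From mathcomp Require Import ring lra zify.
Import Order.TTheory GRing.Theory Num.Theory.
Local Open Scope ring_scope.

(** The bracket of the Heisenberg algebra is [u, w] = omega(u, w) z for an
    alternating form omega, so the Koszul formula reads
      2 <nabla_u v, w> = omega(u, v) <z, w> + omega(w, u) <z, v>
                         + omega(w, v) <z, u>.
    The inner product is nondegenerate, so nabla_u v is the only vector with
    these products, and it can be read off in two cases.  If u and v are both
    orthogonal to the centre, only the first term survives and
    nabla_u v = [u, v] / 2 ([nabla_horizontal]).  If one argument is z, only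
    one term survives because omega(-, z) = 0, and as <z, z> = - lambda, both
    nabla_u z and nabla_z u represent the linear form
    w |-> lambda omega(u, w) / 2
    ([nabla_center]).  For u = f_k the form omega(f_k, -) is the coordinate
    along g_k, that is <g_k, -> / s_k, where s_k is the common square norm of
    f_k and g_k; for u = g_k it is minus the coordinate along f_k.  This gives
    the whole connection on f_1, g_1, ..., f_n, g_n, z.  The orthonormal basis
    is t_k f_k, t_k g_k, z / sqrt lambda with t_k ^ 2 = 1 / s_k, and
    bilinearity transfers the formulas to it. *)

(** * The bracket and the inner product in coordinates *)

Section Connection.
Variables (R : realType) (n : nat) (sigma : nat -> R) (lambda : R).
Local Notation V := 'rV[R]_(2 * n).+1.
Local Notation mu := (@lorentz R n sigma lambda).
Local Notation f := (heis_f R n).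
Local Notation g := (heis_g R n).
Local Notation z := (heis_z R n).
Local Notation v := (onb n sigma lambda).

Definition heis_form (u w : V) : R :=
  \sum_(1 <= k < n.+1)
     (u 0 (ix n (2 * k - 1)) * w 0 (ix n (2 * k))
      - u 0 (ix n (2 * k)) * w 0 (ix n (2 * k - 1))).

Lemma heis_brE (u w : V) : heis_br u w = heis_form u w *: z.
Proof. by []. Qed.

Lemma heis_formC (u w : V) : heis_form u w = - heis_form w u.
Proof. by rewrite /heis_form -sumrN; apply: eq_bigr => k _; ring. Qed.

Lemma heis_form_z (u : V) : heis_form u z = 0.
Proof.
rewrite /heis_form big_nat big1 // => k hk; rewrite /heis_z !delta_ix; try lia.
have /negbTE-> : (2 * n + 1 != 2 * k)%N by lia.
have /negbTE-> : (2 * n + 1 != 2 * k - 1)%N by lia.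
by rewrite !mulr0 subrr.
Qed.

Lemma heis_form_f k (w : V) : (1 <= k <= n)%N ->
  heis_form (f k) w = w 0 (ix n (2 * k)).
Proof.
move=> hk; rewrite /heis_form (bigD1_seq k) ?iota_uniq ?mem_index_iota //=.
rewrite big1_seq ?addr0 => [|j]; rewrite ?mem_index_iota.
  rewrite /heis_f !delta_ix; try lia.
  have /negbTE-> : (2 * k - 1 != 2 * k)%N by lia.
  by rewrite eqxx mul1r mul0r subr0.
move=> /andP[jk hj]; rewrite /heis_f !delta_ix; try lia.
have /negbTE-> : (2 * k - 1 != 2 * j - 1)%N by lia.
have /negbTE-> : (2 * k - 1 != 2 * j)%N by lia.
by rewrite !mul0r subrr.
Qed.

Lemma heis_form_g k (w : V) : (1 <= k <= n)%N ->
  heis_form (g k) w = - w 0 (ix n (2 * k - 1)).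
Proof.
move=> hk; rewrite /heis_form (bigD1_seq k) ?iota_uniq ?mem_index_iota //=.
rewrite big1_seq ?addr0 => [|j]; rewrite ?mem_index_iota.
  rewrite /heis_g !delta_ix; try lia.
  have /negbTE-> : (2 * k != 2 * k - 1)%N by lia.
  by rewrite eqxx mul1r mul0r sub0r.
move=> /andP[jk hj]; rewrite /heis_g !delta_ix; try lia.
have /negbTE-> : (2 * k != 2 * j - 1)%N by lia.
have /negbTE-> : (2 * k != 2 * j)%N by lia.
by rewrite !mul0r subrr.
Qed.

(** The square norm of f_k and of g_k.  Setting it to 1 at k = n makes the
    last pair an instance of the general formulas. *)
Definition plane_norm (k : nat) : R := if (k <= n - 1)%N then sigma k else 1.

Lemma lorentz_f k (w : V) : (1 <= k <= n)%N ->
  mu (f k) w = plane_norm k * w 0 (ix n (2 * k - 1)).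
Proof.
move=> hk; rewrite lorentzC /heis_f lorentz_delta mxE val_ix; last lia.
congr (_ * _); rewrite /plane_norm.
have -> : ((2 * k - 1).-1 < 2 * (n - 1))%N = (k <= n - 1)%N by lia.
have -> : ((2 * k - 1).-1 < 2 * n)%N by lia.
by have -> : ((2 * k - 1).-1./2.+1 = k)%N by lia.
Qed.

Lemma lorentz_g k (w : V) : (1 <= k <= n)%N ->
  mu (g k) w = plane_norm k * w 0 (ix n (2 * k)).
Proof.
move=> hk; rewrite lorentzC /heis_g lorentz_delta mxE val_ix; last lia.
congr (_ * _); rewrite /plane_norm.
have -> : ((2 * k).-1 < 2 * (n - 1))%N = (k <= n - 1)%N by lia.
have -> : ((2 * k).-1 < 2 * n)%N by lia.
by have -> : ((2 * k).-1./2.+1 = k)%N by lia.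
Qed.

Lemma lorentz_z (w : V) : mu z w = - lambda * w 0 (ix n (2 * n + 1)).
Proof.
rewrite lorentzC /heis_z lorentz_delta mxE val_ix; last lia.
by rewrite !ifF //; lia.
Qed.

Lemma lorentz_zz : mu z z = - lambda.
Proof. by rewrite lorentz_z /heis_z delta_ix ?eqxx ?mulr1 //; lia. Qed.

Lemma lorentz_zf k : (1 <= k <= n)%N -> mu z (f k) = 0.
Proof.
move=> hk; rewrite lorentz_z /heis_f delta_ix; try lia.
have /negbTE-> : (2 * k - 1 != 2 * n + 1)%N by lia.
by rewrite mulr0.
Qed.

Lemma lorentz_zg k : (1 <= k <= n)%N -> mu z (g k) = 0.
Proof.
move=> hk; rewrite lorentz_z /heis_g delta_ix; try lia.
have /negbTE-> : (2 * k != 2 * n + 1)%N by lia.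
by rewrite mulr0.
Qed.

Lemma lorentzZl c (u w : V) : mu (c *: u) w = c * mu u w.
Proof. by rewrite linearZl_LR. Qed.

(** * The connection on the standard basis *)

Hypothesis n_ge1 : (1 <= n)%N.
Hypothesis lambda_gt0 : 0 < lambda.
Hypothesis sigma_ge1 : forall k : nat, (1 <= k <= n - 1)%N -> 1 <= sigma k.
Variable nabla : {bilinear V -> V -> V}.
Hypothesis nablaP : levi_civita (@heis_br R n) mu nabla.

Lemma plane_norm_gt0 k : (1 <= k)%N -> 0 < plane_norm k.
Proof.
move=> k1; rewrite /plane_norm; case: ifP => // hk.
by apply: (lt_le_trans ltr01); apply: sigma_ge1; rewrite k1.
Qed.

Lemma nabla_heis_eq (u w x : V) :
  (forall y, 2 * mu x y = heis_form u w * mu z y + heis_form y u * mu z w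
                          + heis_form y w * mu z u) ->
  nabla u w = x.
Proof.
move=> hx; apply/eqP; rewrite -subr_eq0; apply/eqP.
apply: (@lorentz_nondeg R n sigma lambda) => // y.
rewrite linearBl /=; have := nablaP u w y.
rewrite !heis_brE !lorentzZl -hx => /mulfI -> ; first by rewrite subrr.
by rewrite pnatr_eq0.
Qed.

Lemma nabla_horizontal (u w : V) : mu z u = 0 -> mu z w = 0 ->
  nabla u w = 2^-1 *: heis_br u w.
Proof.
move=> zu zw; apply: nabla_heis_eq => y.
by rewrite heis_brE !lorentzZl zu zw; field.
Qed.

(** A vector x with 2 <x, -> = lambda omega(u, -) is the value of the
    connection on u and z in either order, because omega(u, z) = 0 kills the
    only term of the Koszul formula that is not symmetric in u and z. *)
Lemma nabla_center (u x : V) :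
  (forall y, 2 * mu x y = lambda * heis_form u y) ->
  nabla u z = x /\ nabla z u = x.
Proof.
move=> hx.
have zf y : heis_form z y = 0 by rewrite heis_formC heis_form_z oppr0.
by split; apply: nabla_heis_eq => y;
  rewrite hx lorentz_zz !heis_form_z ?zf (heis_formC y u); ring.
Qed.

Lemma nabla_zz : nabla z z = 0.
Proof.
have [] // := @nabla_center z 0 => y.
by rewrite linear0l heis_formC heis_form_z oppr0 !mulr0.
Qed.

Lemma nabla_fz k : (1 <= k <= n)%N ->
  nabla (f k) z = (lambda / (2 * plane_norm k)) *: g k
  /\ nabla z (f k) = (lambda / (2 * plane_norm k)) *: g k.
Proof.
move=> hk; apply: nabla_center => y.
rewrite lorentzZl lorentz_g // heis_form_f //.
by have /gt_eqF/negbT s0 := @plane_norm_gt0 k ltac:(lia); field.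
Qed.

Lemma nabla_gz k : (1 <= k <= n)%N ->
  nabla (g k) z = (- (lambda / (2 * plane_norm k))) *: f k
  /\ nabla z (g k) = (- (lambda / (2 * plane_norm k))) *: f k.
Proof.
move=> hk; apply: nabla_center => y.
rewrite lorentzZl lorentz_f // heis_form_g //.
by have /gt_eqF/negbT s0 := @plane_norm_gt0 k ltac:(lia); field.
Qed.

Lemma nabla_ff i j : (1 <= i <= n)%N -> (1 <= j <= n)%N ->
  nabla (f i) (f j) = 0.
Proof.
move=> hi hj; rewrite nabla_horizontal ?lorentz_zf //.
by case: (heis_br_table R hi hj) => _ -> *; rewrite scaler0.
Qed.

Lemma nabla_gg i j : (1 <= i <= n)%N -> (1 <= j <= n)%N ->
  nabla (g i) (g j) = 0.
Proof.
move=> hi hj; rewrite nabla_horizontal ?lorentz_zg //.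
by case: (heis_br_table R hi hj) => _ _ -> *; rewrite scaler0.
Qed.

Lemma nabla_fg i j : (1 <= i <= n)%N -> (1 <= j <= n)%N ->
  nabla (f i) (g j) = ((i == j)%:R / 2) *: z.
Proof.
move=> hi hj; rewrite nabla_horizontal ?lorentz_zg ?lorentz_zf //.
by case: (heis_br_table R hi hj) => -> *; rewrite scalerA mulrC.
Qed.

Lemma nabla_gf i j : (1 <= i <= n)%N -> (1 <= j <= n)%N ->
  nabla (g j) (f i) = - (((i == j)%:R / 2) *: z).
Proof.
move=> hi hj; rewrite -nabla_fg // !nabla_horizontal ?lorentz_zg ?lorentz_zf //.
by rewrite !heis_brE heis_formC scaleNr scalerN.
Qed.

(** * Passage to the orthonormal basis *)

Lemma onb_f k : (1 <= k <= n)%N ->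
  v (2 * k - 1) = (Num.sqrt (plane_norm k))^-1 *: f k.
Proof.
move=> hk; rewrite /plane_norm; case: ifP => kn; first by rewrite onb_odd //; lia.
have -> : k = n by lia.
by case: (onb_last sigma lambda n_ge1) => -> _ _; rewrite sqrtr1 invr1 scale1r.
Qed.

Lemma onb_g k : (1 <= k <= n)%N ->
  v (2 * k) = (Num.sqrt (plane_norm k))^-1 *: g k.
Proof.
move=> hk; rewrite /plane_norm; case: ifP => kn; first by rewrite onb_even //; lia.
have -> : k = n by lia.
by case: (onb_last sigma lambda n_ge1) => _ -> _; rewrite sqrtr1 invr1 scale1r.
Qed.

Lemma onb_z : v (2 * n + 1) = (Num.sqrt lambda)^-1 *: z.
Proof. by case: (onb_last sigma lambda n_ge1). Qed.

Lemma nablaZ c d (u w : V) : nabla (c *: u) (d *: w) = (c * d) *: nabla u w.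
Proof. by rewrite linearZl_LR linearZr_LR /= scalerA. Qed.

Lemma nabla_onb_plane k : (1 <= k <= n)%N ->
  let c := Num.sqrt lambda / (2 * plane_norm k) in
  (nabla (v (2 * k - 1)%N) (v (2 * k)%N) = c *: v (2 * n + 1)%N
   /\ - nabla (v (2 * k)%N) (v (2 * k - 1)%N) = c *: v (2 * n + 1)%N)
  /\ (nabla (v (2 * k - 1)%N) (v (2 * n + 1)%N) = c *: v (2 * k)%N
      /\ nabla (v (2 * n + 1)%N) (v (2 * k - 1)%N) = c *: v (2 * k)%N)
  /\ (nabla (v (2 * k)%N) (v (2 * n + 1)%N) = - c *: v (2 * k - 1)%N
      /\ nabla (v (2 * n + 1)%N) (v (2 * k)%N) = - c *: v (2 * k - 1)%N).
Proof.
move=> hk c; rewrite !onb_f // !onb_g // onb_z !nablaZ.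
have [-> ->] := nabla_fz _ hk; have [-> ->] := nabla_gz _ hk.
rewrite nabla_fg // nabla_gf // eqxx scalerN opprK !scalerA /c mulr1n.
have s0 := @plane_norm_gt0 k ltac:(lia).
(* Square roots r = sqrt lambda and t = sqrt s_k become the variables, so that
   each coefficient identity is one of rational functions in r and t. *)
have r0 : Num.sqrt lambda != 0 by rewrite gt_eqF // sqrtr_gt0.
have t0 : Num.sqrt (plane_norm k) != 0 by rewrite gt_eqF // sqrtr_gt0.
have rE : lambda = Num.sqrt lambda ^+ 2 by rewrite sqr_sqrtr // ltW.
have tE : plane_norm k = Num.sqrt (plane_norm k) ^+ 2 by rewrite sqr_sqrtr // ltW.
move: (Num.sqrt lambda) (Num.sqrt (plane_norm k)) r0 t0 rE tE => r t r0 t0 -> ->.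
by do !split; congr (_ *: _); field; rewrite ?r0 ?t0.
Qed.

(** Numbering the basis vectors from 1 mixes f, g and z in one index; a case
    analysis on this view recovers the kind of vector and its plane. *)
Variant onb_index_spec (a : nat) : Prop :=
| OnbF k of (1 <= k <= n)%N & a = (2 * k - 1)%N
| OnbG k of (1 <= k <= n)%N & a = (2 * k)%N
| OnbZ of a = (2 * n + 1)%N.

Lemma onb_indexP a : (1 <= a <= 2 * n + 1)%N -> onb_index_spec a.
Proof.
move=> ha; have [an|an] := leqP a (2 * n); last by apply: OnbZ; lia.
have [oa|ea] := boolP (odd a).
  by apply: (@OnbF a (uphalf a)); lia.
by apply: (@OnbG a (uphalf a)); lia.
Qed.

Lemma nabla_onb_diag a : (1 <= a <= 2 * n + 1)%N -> nabla (v a) (v a) = 0.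
Proof.
by case/onb_indexP => [k hk|k hk|] ->;
  rewrite ?onb_z ?onb_f ?onb_g // nablaZ ?nabla_zz ?nabla_ff ?nabla_gg // scaler0.
Qed.

Lemma nabla_onb_unlisted a b :
  (1 <= a <= 2 * n + 1)%N -> (1 <= b <= 2 * n + 1)%N ->
  ~ listed_pair n a b -> nabla (v a) (v b) = 0.
Proof.
move=> ha hb nab.
have out k (hk : (1 <= k <= n)%N) : _ -> nabla (v a) (v b) = 0 :=
  fun ab => False_ind _ (nab (ex_intro2 _ _ k hk ab)).
case: (onb_indexP a ha) (onb_indexP b hb) => [i hi|i hi|] ea [j hj|j hj|] eb.
- by rewrite ea eb !onb_f // nablaZ nabla_ff // scaler0.
- have [ij|ij] := eqVneq i j.
    by apply: (out i hi); rewrite ea eb ij !inE !xpair_eqE !eqxx ?orbT.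
  rewrite ea eb onb_f // onb_g // nablaZ nabla_fg // (negbTE ij).
  by rewrite mul0r scale0r scaler0.
- by apply: (out i hi); rewrite ea eb !inE !xpair_eqE !eqxx ?orbT.
- have [ij|ij] := eqVneq j i.
    by apply: (out i hi); rewrite ea eb ij !inE !xpair_eqE !eqxx ?orbT.
  rewrite ea eb onb_f // onb_g // nablaZ nabla_gf // (negbTE ij).
  by rewrite mul0r scale0r oppr0 scaler0.
- by rewrite ea eb !onb_g // nablaZ nabla_gg // scaler0.
- by apply: (out i hi); rewrite ea eb !inE !xpair_eqE !eqxx ?orbT.
- by apply: (out j hj); rewrite ea eb !inE !xpair_eqE !eqxx ?orbT.
- by apply: (out j hj); rewrite ea eb !inE !xpair_eqE !eqxx ?orbT.
- by rewrite ea eb onb_z nablaZ nabla_zz scaler0.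
Qed.

End Connection.

Theorem theorem3p2 (R : realType) (n : nat) (lambda : R) (sigma : nat -> R)
    (n_ge1 : (1 <= n)%N)
    (lambda_gt0 : 0 < lambda)
    (sigma_noninc : forall i j : nat,
       (1 <= i)%N -> (i <= j)%N -> (j <= n - 1)%N -> sigma j <= sigma i)
    (sigma_ge1 : forall k : nat, (1 <= k <= n - 1)%N -> 1 <= sigma k)
    (nabla : {bilinear 'rV[R]_(2 * n).+1 -> 'rV[R]_(2 * n).+1
                       -> 'rV[R]_(2 * n).+1})
    (nablaP : levi_civita (@heis_br R n) (@lorentz R n sigma lambda) nabla) :
  let v := onb n sigma lambda in
  (forall i : nat, (1 <= i <= 2 * n + 1)%N -> nabla (v i) (v i) = 0)
  /\ (forall k : nat, (1 <= k <= n - 1)%N ->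
      let c := Num.sqrt lambda / (2 * sigma k) in
      (nabla (v (2 * k - 1)%N) (v (2 * k)%N) = c *: v (2 * n + 1)%N
       /\ - nabla (v (2 * k)%N) (v (2 * k - 1)%N) = c *: v (2 * n + 1)%N)
      /\ (nabla (v (2 * k - 1)%N) (v (2 * n + 1)%N) = c *: v (2 * k)%N
          /\ nabla (v (2 * n + 1)%N) (v (2 * k - 1)%N) = c *: v (2 * k)%N)
      /\ (nabla (v (2 * k)%N) (v (2 * n + 1)%N) = - c *: v (2 * k - 1)%N
          /\ nabla (v (2 * n + 1)%N) (v (2 * k)%N) = - c *: v (2 * k - 1)%N))
  /\ (let c := Num.sqrt lambda / 2 in
      (nabla (v (2 * n - 1)%N) (v (2 * n)%N) = c *: v (2 * n + 1)%N
       /\ - nabla (v (2 * n)%N) (v (2 * n - 1)%N) = c *: v (2 * n + 1)%N)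
      /\ (nabla (v (2 * n - 1)%N) (v (2 * n + 1)%N) = c *: v (2 * n)%N
          /\ nabla (v (2 * n + 1)%N) (v (2 * n - 1)%N) = c *: v (2 * n)%N)
      /\ (nabla (v (2 * n)%N) (v (2 * n + 1)%N) = - c *: v (2 * n - 1)%N
          /\ nabla (v (2 * n + 1)%N) (v (2 * n)%N) = - c *: v (2 * n - 1)%N))
  /\ (forall a b : nat, (1 <= a <= 2 * n + 1)%N -> (1 <= b <= 2 * n + 1)%N ->
      ~ listed_pair n a b -> nabla (v a) (v b) = 0).
Proof.
move=> v; split; [|split; [|split]].
- exact: nabla_onb_diag.
- move=> k hk c.
  have := @nabla_onb_plane R n sigma lambda n_ge1 lambda_gt0 sigma_ge1 nabla nablaP k.
  rewrite /plane_norm ifT; last lia.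
  by apply; lia.
- have := @nabla_onb_plane R n sigma lambda n_ge1 lambda_gt0 sigma_ge1 nabla nablaP n.
  rewrite /plane_norm ifF; last lia.
  by rewrite mulr1; apply; lia.
- exact: nabla_onb_unlisted.
Qed.
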